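(* Let $S=\big(s(t)(I)\big)_{t\in[m],\,I\in\Pi_{t,k_t}}\in\mathcal{S}_\infty$. The shuffle associated with the order $\prec_S$ is given by $(\mathcal{P}_S,\prec_S)$, where the parts of the partition $\mathcal{P}_S$ are the (nonempty) sets $$P(t)(J)=\{\,s(t)(J,i_{t,k_t}) : i_{t,k_t}\in[m_{t,k_t}]\,\},\qquad t\in[m],\ J\in\Pi_{t,k_t-1}.$$ In other words, $\mathcal{P}_S$ is a partition of $\mathbb{N}$ and $(\mathcal{P}_S,\prec_S)$ is a shuffle.
   Context: $\mathbb{N}=\{0,1,2,\dots\}$. A shuffle is a pair $(\mathcal{P},\prec)$ where $\mathcal{P}$ is a partition of $\mathbb{N}$ and $\prec$ is a strict total order on $\mathbb{N}$ such that whenever $x,y\in X\in\mathcal{P}$, $z\in X'\in\mathcal{P}$ and $x\prec z\prec y$, then $X=X'$. For $m\in\mathbb{N}$ let $[m]=\{0,\dots,m-1\}$; also $[+\infty]=\mathbb{N}$ and $[-\infty]=-\mathbb{N}=\{\dots,-2,-1,0\}$. Uniform sets. For $t\in\mathbb{N}$ and $\varepsilon\in\{+,-\}$, $\mathcal{U}_{2t}^{\varepsilon}$ is the set of families $(s(i_0,\dots,i_t))$ of natural numbers indexed by $[m_0]\times[m_1]\times\cdots\times[m_t]$, where $m_0\in\mathbb{N}$ is arbitrary (finite) and $m_1=\cdots=m_t=\varepsilon\infty$; $\mathcal{U}_{2t+1}^{\varepsilon}$ is the set of such families with $m_0=\cdots=m_t=\varepsilon\infty$. Set $\mathcal{U}_d=\mathcal{U}_d^+\cup\mathcal{U}_d^-$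 and $\mathcal{U}=\bigcup_{d\ge0}\mathcal{U}_d$. Mixed sets. $\mathcal{U}_\infty$ is the set of nonempty finite or infinite sequences $S=(S_t)_{t\in[m]}$, $m\in\{1,2,\dots\}\cup\{+\infty\}$, with $S_t\in\mathcal{U}$. Write $S_t=\big(s(t)(I)\big)_{I\in\Pi_{t,k_t}}$ with $\Pi_{t,k_t}=[m_{t,1}]\times\cdots\times[m_{t,k_t}]$, where $k_t$ is the number of indices of $S_t$, and $\Pi_{t,k_t-1}=[m_{t,1}]\times\cdots\times[m_{t,k_t-1}]$ (a single empty tuple if $k_t=1$). Let $\langle S\rangle\subseteq\mathbb{N}$ be the set of all values $s(t)(I)$. $S$ is injective if $s(t)(I)\ne s(p)(J)$ whenever $(t,I)\neq(p,J)$. Let $\mathcal{S}_\infty=\{S\in\mathcal{U}_\infty:\langle S\rangle=\mathbb{N},\ S\text{ injective}\}$. For $S\in\mathcal{S}_\infty$ and $x=s(t)(i_{t,1},\dots,i_{t,k_t})$, the address is $\mathsf{ad}_S(x)=(t,i_{t,1},\dots,i_{t,k_t})$. The order $\prec_S$ on $\mathbb{N}$ is defined by $x\prec_S y$ iff $\mathsf{ad}_S(x)\vartriangleleft\mathsf{ad}_S(y)$, where $\vartriangleleft$ is the lexicographic order on $\bigcup_{k\ge1}\mathbb{Z}^k$ (entries compared by the usual order of $\mathbb{Z}$, a proper prefix being smaller). *)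

(* Defs.v *)
From HB Require Import structures.
From mathcomp Require Import all_boot all_order all_algebra.
From mathcomp Require Import boolp classical_sets functions.
Set Implicit Arguments.
Unset Strict Implicit.
Unset Printing Implicit Defensive.
Import Order.TTheory GRing.Theory Num.Theory.
Import Order.DefaultSeqLexiOrder.
Local Open Scope classical_set_scope.
Local Open Scope ring_scope.

Definition strict_total_order (prec : rel nat) : Prop :=
  [/\ irreflexive prec, transitive prec &
      forall x y, [|| prec x y, x == y | prec y x]].

Definition is_shuffle (P : set (set nat)) (prec : rel nat) : Prop :=
  [/\ partition P id [set: nat], strict_total_order prec &
      forall (X X' : set nat) (x y z : nat), P X -> P X' ->
        X x -> X y -> X' z -> prec x z -> prec z y -> X = X'].

Variant bound := Fin of nat | Infty of bool.
Notation pinf := (Infty true).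
Notation minf := (Infty false).

(* The index set written [m] in the text, for m a natural number, +oo or -oo. *)
Definition index_itv (m : bound) : interval int :=
  match m with
  | Fin n => `[0, n%:Z[
  | pinf => `[0, +oo[
  | minf => `]-oo, 0]
  end.

Definition box (ms : seq bound) : set (seq int) :=
  [set I | all2 (fun i m => i \in index_itv m) I ms].

(* A family of natural numbers indexed by box (bounds F). The function entry   *)
(* is total, but only its values on that box are ever used.                    *)
Record family := Family { bounds : seq bound; entry : seq int -> nat }.

Definition nb_indices (F : family) : nat := size (bounds F).

(* eps is true for the sign + and false for the sign -; both parities of d     *)
(* give families with d./2.+1 indices.                                         *)
Definition uniform_signed (d : nat) (eps : bool) : set family :=
  [set F | if odd d then bounds F = nseq d./2.+1 (Infty eps)
           else exists m0 : nat, bounds F = Fin m0 :: nseq d./2 (Infty eps)].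

Definition uniform_deg (d : nat) : set family :=
  uniform_signed d true `|` uniform_signed d false.

Definition uniform : set family := \bigcup_d uniform_deg d.

(* A sequence (S_t) for t in [len S]; term S t is irrelevant for other t.      *)
Record mixed := Mixed { len : bound; term : nat -> family }.

Definition in_len (S : mixed) (t : nat) : bool := t%:Z \in index_itv (len S).

Definition mixed_uniform : set mixed :=
  [set S | ((exists2 m : nat, (0 < m)%N & len S = Fin m) \/ len S = pinf) /\
           forall t, in_len S t -> uniform (term S t)].

Definition positions (S : mixed) : set (nat * seq int) :=
  [set p | in_len S p.1 /\ box (bounds (term S p.1)) p.2].

Definition value (S : mixed) (p : nat * seq int) : nat :=
  entry (term S p.1) p.2.

Definition values (S : mixed) : set nat := value S @` positions S.

Definition injective_mixed (S : mixed) : Prop :=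
  set_inj (positions S) (value S).

Definition S_infty : set mixed :=
  [set S | [/\ mixed_uniform S, values S = [set: nat] & injective_mixed S]].

(* For S in S_infty each x is the value at exactly one position, so that xget  *)
(* returns it and the default (0, [::]) is never used.                         *)
Definition address (S : mixed) (x : nat) : seq int :=
  let p := xget (0%N, [::]) [set p | positions S p /\ value S p = x] in
  p.1%:Z :: p.2.

(* The library's order on seqlexi compares entries first and makes a proper    *)
(* prefix smaller.                                                             *)
Definition address_order (S : mixed) : rel nat :=
  fun x y => (address S x < address S y :> seqlexi int)%O.

(* The set P(t)(J) of the values s(t)(J, i), where i is the last index.        *)
Definition block (S : mixed) (t : nat) (J : seq int) : set nat :=
  let ms := bounds (term S t) in
  [set value S (t, rcons J i) |
     i in [set i : int | i \in index_itv (last (Fin 0) ms)]].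

Definition block_index (S : mixed) (t : nat) : set (seq int) :=
  box (take (nb_indices (term S t)).-1 (bounds (term S t))).

(* A term with one index and bound m0 = 0 has an empty block, which is not a   *)
(* part.                                                                       *)
Definition parts (S : mixed) : set (set nat) :=
  [set X | X !=set0 /\
     exists t J, [/\ in_len S t, block_index S t J & X = block S t J]].

(* Main.v *)
Require Import Defs.
From mathcomp Require Import all_boot all_order all_algebra.
From mathcomp Require Import boolp classical_sets functions.
Import Order.TTheory Order.DefaultSeqLexiOrder.
Local Open Scope classical_set_scope.

(** Injectivity makes the address a faithful name: the value at position (t, I)
    has address t :: I, so two values with one address coincide.  Since the
    lexicographic order is a strict total order, so is the order it induces on
    the naturals through addresses.

    A uniform family has at least one index, so every address can be written
    t :: rcons J i, and erasing its last entry leaves t :: J exactly for the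
    values in the part P(t)(J) ([parts_cover], [parts_address]).  Hence x
    determines the part it lies in, which gives the partition.

    For convexity, let x and y lie in P(t)(J) and z in P(t')(J') with x before
    z before y.  Comparing first entries gives t <= t' <= t, so t = t'; then J
    and J' have the same length, one less than the number of indices of S_t,
    and for words of equal length erasing the last letter is monotone
    ([lexi_rcons_prefix]), so J <= J' <= J and the two parts are equal. *)

(** For words of unequal length, erasing the last letter can fail to be
    monotone: [:: 0; 5] <= [:: 1], but [:: 0] <= [::] fails. *)
Lemma lexi_rcons_prefix (u v : seq int) (a b : int) : size u = size v ->
  (rcons u a <= rcons v b :> seqlexi int)%O -> (u <= v :> seqlexi int)%O.
Proof.
elim: u v => [|x u IHu] [|y v] //= [suv].
rewrite !lexi_cons => /andP[-> /implyP le_uv] /=.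
by apply/implyP => /le_uv; apply: IHu.
Qed.

Lemma box_rcons (ms : seq bound) (m : bound) (J : seq int) (i : int) :
  box (rcons ms m) (rcons J i) <-> box ms J /\ i \in index_itv m.
Proof.
rewrite /box /= !all2E !size_rcons eqSS; split.
  case/andP=> /eqP sJ; rewrite zip_rcons // all_rcons => /andP[/= -> ->].
  by rewrite sJ eqxx.
case=> /andP[/eqP sJ aJ] im.
by rewrite sJ eqxx zip_rcons // all_rcons /= im aJ.
Qed.

Lemma position_rcons (S : mixed) (t : nat) (J : seq int) (i : int) :
  positions S (t, rcons J i) <->
  [/\ in_len S t, block_index S t J &
      i \in index_itv (last (Fin 0) (bounds (term S t)))].
Proof.
suff bE : box (bounds (term S t)) (rcons J i) <->
    block_index S t J /\ i \in index_itv (last (Fin 0) (bounds (term S t))).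
  by split=> [[/= St /bE[]]|[St BJ ii]] //; split=> //=; apply/bE.
rewrite /block_index /nb_indices.
case/lastP: (bounds _) => [|ms m].
  (* With no index both sides fail: the default bound Fin 0 has empty range. *)
  split=> [|[_]]; first by rewrite /box /=; case: J.
  by rewrite /= in_itv /= => /andP[/le_lt_trans/[apply]]; rewrite ltxx.
rewrite last_rcons size_rcons [X in box (take _ X)]/= -[in take _ _]cats1.
by rewrite take_size_cat //; exact: box_rcons.
Qed.

Lemma uniform_bounds_gt0 (F : Defs.family) :
  uniform F -> (0 < size (bounds F))%N.
Proof.
by case=> d _ []; rewrite /uniform_signed /=; case: odd => [->|[m ->]].
Qed.

Section Addresses.
Context {S : mixed} (hS : S_infty S).

Lemma address_value (p : nat * seq int) :
  positions S p -> address S (value S p) = Posz p.1 :: p.2.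
Proof.
case: hS => _ _ injS Sp; rewrite /address.
have [Sq eq_qp] := @xgetI _ (0%N, [::])
  [set q | positions S q /\ value S q = value S p] p (conj Sp erefl).
by rewrite (injS _ _ (mem_set Sq) (mem_set Sp) eq_qp).
Qed.

Lemma position_of (x : nat) : exists2 p, positions S p & value S p = x.
Proof.
case: hS => _ surjS _.
by have : values S x by rewrite surjS.
Qed.

Lemma address_inj : injective (address S).
Proof.
move=> x y.
have [[t I] Sp <-] := position_of x; have [[u J] Sq <-] := position_of y.
by rewrite !address_value //= => -[-> ->].
Qed.

Lemma parts_cover (x : nat) : exists2 X, parts S X & X x.
Proof.
have [[t I] Sp xE] := position_of x.
(* The word I is nonempty because the term t has an index. *)
case/lastP: I Sp xE => [|J i] Sp xE.
  case: hS => -[_ unifS] _ _; case: Sp => /= St.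
  have := uniform_bounds_gt0 _ (unifS _ St).
  by rewrite /box /=; case: bounds.
have [St BJ ii] := (position_rcons S t J i).1 Sp.
have xJ : block S t J x by exists i.
by exists (block S t J) => //; split; [exists x | exists t, J].
Qed.

(** All addresses in a part agree up to the last entry.  The length of J is
    determined by t, so that two parts of the same term can be compared with
    [lexi_rcons_prefix]. *)
Lemma parts_address (X : set nat) : parts S X ->
  exists t J, [/\ X = block S t J, size J = (nb_indices (term S t)).-1 &
    forall x, X x -> exists i, address S x = Posz t :: rcons J i].
Proof.
case=> _ [t [J [St BJ ->]]]; exists t, J; split=> //.
  move: BJ; rewrite /block_index /box /= all2E => /andP[/eqP-> _].
  by rewrite size_takel // leq_pred.
move=> _ [i ii <-]; exists i.
by rewrite address_value //; apply/position_rcons.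
Qed.

Lemma parts_partition : partition (parts S) id [set: nat].
Proof.
split=> [|X Y PX PY [x [Xx Yx]]|X []] //.
  apply/seteqP; split=> // x _.
  by have [X PX Xx] := parts_cover x; exists X.
have [t [J [XE _ /(_ x Xx)[i xE]]]] := parts_address _ PX.
have [u [K [YE _ /(_ x Yx)[j]]]] := parts_address _ PY.
by rewrite xE XE YE => -[-> /rcons_inj[-> _]].
Qed.

Lemma address_order_total : strict_total_order (address_order S).
Proof.
split=> [x|y x z|x y]; rewrite /address_order; first exact: ltxx.
  exact: lt_trans.
by rewrite -(inj_eq address_inj); case: ltgtP.
Qed.

Lemma parts_convex (X Y : set nat) (x y z : nat) : parts S X -> parts S Y ->
  X x -> X y -> Y z -> address_order S x z -> address_order S z y -> X = Y.
Proof.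
move=> PX PY Xx Xy Yz; rewrite /address_order.
have [t [J [XE sJ aX]]] := parts_address _ PX.
have [u [K [YE sK aY]]] := parts_address _ PY.
have [i ->] := aX _ Xx; have [j ->] := aX _ Xy; have [k ->] := aY _ Yz.
rewrite {}XE {}YE => /ltW le_xz /ltW le_zy.
have [tu] : Posz t = Posz u.
  by apply/eqP; rewrite eq_le (lexi_lehead le_xz) (lexi_lehead le_zy).
move: le_xz le_zy; rewrite -tu !eqhead_lexiE => le_JK le_KJ.
have sJK : size J = size K by rewrite sJ sK tu.
congr (block S t _); apply: (@le_anti _ (seqlexi int)).
by rewrite (lexi_rcons_prefix _ _ _ _ sJK le_JK)
           (lexi_rcons_prefix _ _ _ _ (esym sJK) le_KJ).
Qed.

End Addresses.

Theorem proposition3p21 (S : mixed) (hS : S_infty S) :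
  partition (parts S) id [set: nat] /\ is_shuffle (parts S) (address_order S).
Proof.
have part := parts_partition hS.
split=> //; split=> //; first exact: address_order_total.
exact: parts_convex.
Qed.
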